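(* Let $X$ be a compact metrizable space without isolated points, and let $C_1(X)=\{x\in X : \{x\}\text{ is a connected component of }X\}$. The following are equivalent: (1) $X$ has a card with a maximal $1$- or $2$-point compactification; (2) $X$ has a card with a maximal finite compactification; (3) $C_1(X)$ is not dense in $X$; (4) $C_1(X)$ does not form a dense $G_\delta$ of size $\mathfrak{c}=2^{\aleph_0}$, i.e. it is not the case that $C_1(X)$ is a dense $G_\delta$ subset of $X$ of cardinality $\mathfrak{c}$.
   Context: A card of $X$ is a space homeomorphic to $X\setminus\{x\}$ for some $x\in X$. For $N\in\mathbb{N}$, an $N$-point compactification of a space $Y$ is a Hausdorff compactification $\gamma Y$ of $Y$ whose remainder $\gamma Y\setminus Y$ has cardinality $N$. A finite compactification of $Y$ is an $N$-point compactification for some $N\in\mathbb{N}$. An $N$-point compactification of $Y$ is maximal if for every finite compactification $\gamma Y$ of $Y$ with $|\gamma Y\setminus Y|=M$ we have $M\le N$. A maximal finite compactification is a maximal $N$-point compactification for some $N$. A $G_\delta$ set is a countable intersection of open sets. *)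

(* Defs.v *)
From HB Require Import structures.
From mathcomp Require Import all_boot all_order all_algebra.
From mathcomp Require Import all_classical all_reals topology borel_hierarchy.
Set Implicit Arguments.
Unset Strict Implicit.
Unset Printing Implicit Defensive.

Local Open Scope classical_set_scope.
Local Open Scope card_scope.

Definition homeomorphic (X Y : topologicalType) : Prop :=
  exists (f : X -> Y) (g : Y -> X),
    [/\ cancel f g, cancel g f, continuous f & continuous g].

Definition metrizable (R : realType) (X : topologicalType) : Prop :=
  exists M : metricType R, homeomorphic X M.

(* [set_type [set~ x]] carries the subspace topology inherited from [X]. *)
Definition is_card (X Y : topologicalType) : Prop :=
  exists x : X, homeomorphic Y (set_type [set~ x]).

Definition embedding (X Y : topologicalType) (f : X -> Y) : Prop :=
  injective f /\
  forall U : set X, open U <-> exists2 V : set Y, open V & f @^-1` V = U.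

Definition hausdorff_compactification
    (Y K : topologicalType) (e : Y -> K) : Prop :=
  [/\ compact [set: K], hausdorff_space K, embedding e & dense (range e)].

(* Zero is allowed as a value of [N]; a 0-point compactification exists only
   when [Y] is already compact. *)
Definition point_compactification
    (N : nat) (Y K : topologicalType) (e : Y -> K) : Prop :=
  hausdorff_compactification e /\ ~` range e #= `I_N.

Definition maximal_point_compactification
    (N : nat) (Y K : topologicalType) (e : Y -> K) : Prop :=
  point_compactification N e /\
  forall (M : nat) (K' : topologicalType) (e' : Y -> K'),
    point_compactification M e' -> (M <= N)%N.

Definition has_maximal_point_compactification
    (N : nat) (Y : topologicalType) : Prop :=
  exists (K : topologicalType) (e : Y -> K), maximal_point_compactification N e.

Definition has_maximal_finite_compactification (Y : topologicalType) : Prop :=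
  exists N : nat, has_maximal_point_compactification N Y.

Definition C1 (X : topologicalType) : set X :=
  [set x | connected_component [set: X] x = [set x]].
Arguments C1 X : clear implicits.

(* Main.v *)
Require Import Defs.
From HB Require Import structures.
From mathcomp Require Import all_boot all_order all_algebra.
From mathcomp Require Import all_classical all_reals topology borel_hierarchy.
Local Open Scope classical_set_scope.
Local Open Scope card_scope.

Set Implicit Arguments.
Unset Strict Implicit.
Unset Printing Implicit Defensive.

(** Throughout, [X] is a nonempty compact metrizable space without isolated
    points; it is a compact Hausdorff space with a countable base.

    The components of a compact Hausdorff space are intersections of clopen sets
    ([clopen_pieces_connected]), so a point of [C1 X] has arbitrarily small clopen
    neighbourhoods. Over a countable base this writes [C1 X] as a countable
    intersection of open sets ([C1_bigcap]). If [C1 X] is dense, a Cantor scheme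
    inside these open sets makes it of the size of the continuum ([C1_card]);
    therefore the last two conditions are equivalent.

    If [C1 X] is dense, then for every point [x] a sequence of disjoint clopen sets
    converges to [x]. Distributing the sequence among [n] classes cuts the card at
    [x] into [n] clopen parts that all accumulate at [x], and adding a separate
    limit to each part gives an [n]-point compactification
    ([dense_C1_coloring], [coloring_compactification]). As [n] is arbitrary, no
    card has a maximal finite compactification.

    If [C1 X] is not dense, Baire category gives a nonempty open set [V] that
    contains no nonempty clopen set ([clopen_free_open]). A compactification of the
    card at [x] with at least three points at infinity splits a neighbourhood of
    [x] into three open sectors accumulating at [x]
    ([large_compactification_sectors]). When [x] is in [V], each of the sectors
    contains a nondegenerate connected set through [x] ([sector_continuum]). So [x]
    is the centre of a triod that splits the boundary of a small neighbourhood into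
    three parts, each linked to [x] within its own sector. Countably many codes
    describe such neighbourhoods and boundary partitions, and two points cannot
    share one, because two legs of the first triod would join two different parts
    of the boundary without passing through the second point ([sector_code_inj]). By
    Baire category some point of [V] has no three sectors; its card, which has a
    1-point compactification, has a maximal one with 1 or 2 points. *)

(** * Components and quasi-components in compact Hausdorff spaces *)

(** Were every member to leave [O], the sets [A `\` O] would form a filter base, and
    a cluster point of it would lie in every [A] but outside [O]. *)
Lemma directed_closed_subset_open (X : topologicalType) (E : set (set X)) (O : set X) :
  compact [set: X] -> E !=set0 -> E `<=` closed ->
  (forall A B, E A -> E B -> exists2 C, E C & C `<=` A `&` B) ->
  open O -> \bigcap_(A in E) A `<=` O -> exists2 A, E A & A `<=` O.
Proof.
move=> cX [A0 EA0] Ecl Edir oO EO; apply: contrapT => nE.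
have AO A : E A -> A `\` O !=set0.
  move=> EA; apply: contrapT => AO0; apply: nE; exists A => // z Az.
  by apply: contrapT => Oz; apply: AO0; exists z.
pose F := filter_from E (fun A => A `\` O).
have FF : ProperFilter F.
  apply: filter_from_proper => //; apply: filter_from_filter; first by exists A0.
  move=> A B EA EB; have [C EC CAB] := Edir A B EA EB; exists C => // z [Cz Oz].
  by have [Az Bz] := CAB z Cz.
have [p [_ clp]] := cX F FF filterT.
have Op : O p.
  apply: EO => A EA; apply: Ecl => // U pU.
  have [z [[Az _] Uz]] := clp (A `\` O) U (ex_intro2 _ _ A EA (fun=> id)) pU.
  by exists z.
have [z [[_ nOz] Oz]] := clp (A0 `\` O) O (ex_intro2 _ _ A0 EA0 (fun=> id))
  (open_nbhs_nbhs (conj oO Op)).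
exact: nOz.
Qed.

Lemma separate_closed (X : topologicalType) (P Q : set X) :
  hausdorff_space X -> compact [set: X] -> closed P -> closed Q ->
  P `&` Q = set0 ->
  exists U V, [/\ open U, open V, P `<=` U, Q `<=` V & U `&` V = set0].
Proof.
move=> hX cX cP cQ PQ.
have PQ' : set_nbhs P (~` Q).
  apply/set_nbhsP; exists (~` Q); split=> //; first exact: closed_openC.
  exact/disjoints_subset.
have [W /set_nbhsP[U [oU PU UW]] WQ] := compact_normal hX cX cP PQ'.
exists U, (~` closure W); split => //.
- exact/closed_openC/closed_closure.
- by move=> z Qz /WQ; apply.
- apply/disjoints_subset; rewrite setCK; apply: subset_trans UW _.
  exact: subset_closure.
Qed.

Lemma regular_nbhs (X : topologicalType) (x : X) (U : set X) :
  hausdorff_space X -> compact [set: X] -> open U -> U x ->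
  exists V, [/\ open V, V x & closure V `<=` U].
Proof.
move=> hX cX oU Ux; have nU : nbhs x U by exact: open_nbhs_nbhs.
have [W nW WU] := compact_regular hX cX (@filterT _ (nbhs x) _) nU.
exists W^°; split; [exact: open_interior | exact: nW |].
by apply: subset_trans WU; apply: closureS; exact: interior_subset.
Qed.

Definition closed_partition (X : topologicalType) (A E F : set X) :=
  [/\ closed E, closed F, E `|` F = A & E `&` F = set0].

(** The relatively clopen subsets of [A] through [x]; their intersection is the
    quasi-component of [x] in [A]. *)
Definition clopen_pieces (X : topologicalType) (A : set X) (x : X) : set (set X) :=
  [set E | E x /\ exists F, closed_partition A E F].

Lemma clopen_pieces_full (X : topologicalType) (A : set X) (x : X) :
  closed A -> A x -> clopen_pieces A x A.
Proof.
by split => //; exists set0; split; [|exact: closed0|rewrite setU0|rewrite setI0].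
Qed.

Lemma clopen_pieces_closed (X : topologicalType) (A : set X) (x : X) :
  clopen_pieces A x `<=` closed.
Proof. by move=> E [_ [F []]]. Qed.

Lemma clopen_pieces_directed (X : topologicalType) (A : set X) (x : X) (A1 A2 : set X) :
  clopen_pieces A x A1 -> clopen_pieces A x A2 ->
  exists2 C, clopen_pieces A x C & C `<=` A1 `&` A2.
Proof.
move=> [A1x [F1 [cA1 cF1 U1 I1]]] [A2x [F2 [cA2 cF2 U2 I2]]].
exists (A1 `&` A2) => //; split => //; exists (F1 `|` F2); split.
- exact: closedI.
- exact: closedU.
- apply/seteqP; split=> z.
    move=> [[A1z _]|[F1z|F2z]]; rewrite -?U1; [by left|by right|].
    by have : (A2 `|` F2) z by [right]; rewrite U2 -U1.
  move=> Az; have := Az; rewrite -{1}U1 => -[A1z|]; last by right; left.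
  by move: Az; rewrite -U2 => -[A2z|]; [left|right; right].
- by rewrite setIUr -setIA (setIC A2) setIA I1 set0I set0U -setIA I2 setI0.
Qed.

(** The classical argument that quasi-components of compact Hausdorff spaces are
    connected. Suppose the intersection [Q] is the disjoint union of closed sets [P]
    and [P'] with [x] in [P]. Separate [P] and [P'] by disjoint open [U] and [V]; by
    compactness some piece [E] lies in [U `|` V], and cutting [V] out of [E] leaves a
    piece, which therefore contains [Q] although it misses [P']. *)
Lemma clopen_pieces_connected (X : topologicalType) (A : set X) (x : X) :
  hausdorff_space X -> compact [set: X] -> closed A -> A x ->
  connected (\bigcap_(E in clopen_pieces A x) E).
Proof.
move=> hX cX cA Ax; set EE := clopen_pieces A x; set Q := \bigcap_(E in EE) E.
have EEA : EE A := clopen_pieces_full cA Ax.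
have EEcl : EE `<=` closed := @clopen_pieces_closed _ A x.
have EEdir := @clopen_pieces_directed _ A x.
have cQ : closed Q by apply: closed_bigI => E /EEcl.
have Qx : Q x by move=> E [].
move=> B B0 [C oC BC] [D cD BD].
have cB : closed B by rewrite BD; exact: closedI.
have cB' : closed (Q `\` B).
  have -> : Q `\` B = Q `&` ~` C.
    by rewrite BC; apply/seteqP; split=> z [Qz nz]; split=> // Cz; apply: nz => //; case: Cz.
  by apply: closedI => //; exact: open_closedC.
(* This is applied to [B] and its complement in [Q], in either order,
   according to which of them contains [x]. *)
have key P P' : closed P -> closed P' -> P `&` P' = set0 -> P `|` P' = Q ->
    P x -> P' `<=` P.
  move=> cP cP' PP' PUP' Px.
  have [U [V [oU oV PU P'V UV]]] := separate_closed hX cX cP cP' PP'.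
  have [] := directed_closed_subset_open cX (ex_intro _ A EEA) EEcl EEdir
    (openU oU oV).
    by rewrite -/Q -PUP'; exact: setUSS.
  move=> E [Ex [F [cE cF EF EIF]]] EUV.
  suff EU : EE (E `\` V).
    move=> z P'z; exfalso.
    have Qz : Q z by rewrite -PUP'; right.
    by have [_] := Qz _ EU; apply; exact: P'V.
  split; first by split=> // Vx; have : (U `&` V) x by [split=> //; exact: PU]; rewrite UV.
  have EV : E `&` V = E `\` U.
    apply/seteqP; split=> z [Ez]; last by move=> nUz; split => //; case: (EUV z Ez).
    by move=> Vz; split=> // Uz; have : (U `&` V) z by []; rewrite UV.
  exists (F `|` (E `\` U)); split.
  - by apply: closedI => //; exact: open_closedC.
  - by apply: closedU => //; apply: closedI => //; exact: open_closedC.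
  - rewrite -EF -EV; apply/seteqP; split=> z.
      by move=> [[Ez _]|[Fz|[Ez _]]]; [left|right|left].
    move=> [Ez|Fz]; last by right; left.
    by have [Vz|nVz] := pselect (V z); [right; right|left].
  - rewrite -EV; apply/seteqP; split=> // z [[Ez nVz] [Fz|[_ //]]].
    by have : (E `&` F) z by []; rewrite EIF.
have BQ : B `<=` Q by rewrite BC => z [].
have I0 : B `&` (Q `\` B) = set0 by rewrite setDE setICA setICr setI0.
have U0 : B `|` (Q `\` B) = Q by rewrite setDUK.
have [Bx|nBx] := pselect (B x).
  apply/seteqP; split=> // z Qz; apply: contrapT => nBz; apply: (nBz).
  by apply: (key _ _ cB cB' I0 U0 Bx).
case: B0 => b Bb; rewrite setIC in I0; rewrite setUC in U0.
by have [] := key _ _ cB' cB I0 U0 (conj Qx nBx) b Bb.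
Qed.

(** The form in which components are used below: a closed set that no connected
    subset of [A] through [x] can reach is cut off from [x] by a relatively clopen
    set. *)
Lemma split_off_closed (X : topologicalType) (A P : set X) (x : X) :
  hausdorff_space X -> compact [set: X] -> closed A -> A x -> closed P ->
  (forall D, connected D -> D `<=` A -> D x -> D `&` P = set0) ->
  exists E F, [/\ closed_partition A E F, E x & E `&` P = set0].
Proof.
move=> hX cX cA Ax cP DP; have cQ := clopen_pieces_connected hX cX cA Ax.
have [//|||||E [Ex [F sEF]] /disjoints_subset EP] :=
  @directed_closed_subset_open X (clopen_pieces A x) (~` P) cX.
- by exists A; exact: clopen_pieces_full.
- exact: clopen_pieces_closed.
- exact: clopen_pieces_directed.
- exact: closed_openC.
- apply/disjoints_subset/DP => //; last by move=> E [].
  by move=> z; apply; exact: clopen_pieces_full.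
- by exists E, F.
Qed.

Lemma C1_clopen_nbhs (X : topologicalType) (x : X) (U : set X) :
  hausdorff_space X -> compact [set: X] -> C1 X x -> open U -> U x ->
  exists E, [/\ clopen E, E x & E `<=` U].
Proof.
move=> hX cX C1x oU Ux.
have [||D cD _ Dx|E [F [[cE cF EF EIF] Ex EU]]] :=
  @split_off_closed X setT (~` U) x hX cX closedT.
- by [].
- exact: open_closedC.
- apply/disjoints_subset; rewrite setCK => z Dz; suff -> : z = x by [].
  have := @connected_component_max X setT D x Dx (@subsetT _ D) cD z Dz.
  by rewrite C1x.
- exists E; split => //; last by move/disjoints_subset: EU; rewrite setCK.
  split => //; have -> : E = ~` F; last exact: closed_openC.
  apply/seteqP; split; first exact/disjoints_subset.
  by move=> z nFz; have : setT z by []; rewrite -EF => -[].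
Qed.

Lemma clopen_connected (X : topologicalType) (E D : set X) (x : X) :
  clopen E -> connected D -> D x -> E x -> D `<=` E.
Proof.
move=> [oE cE] cD Dx Ex.
have <- : D `&` E = D.
  apply: cD; first by exists x.
  - by exists E.
  - by exists E.
by move=> z [].
Qed.

(** * Baire category and the singleton components *)

Definition countable_base (X : topologicalType) (B : nat -> set X) :=
  (forall n, open (B n)) /\
  forall x U, open U -> U x -> exists n, B n x /\ B n `<=` U.

Definition perfect (X : topologicalType) := forall x : X, ~ open [set x].

Lemma perfect_open_other (X : topologicalType) (V : set X) (x : X) :
  perfect X -> open V -> V !=set0 -> exists2 y, V y & y <> x.
Proof.
move=> pX oV [v Vv]; apply: contrapT => nV.
have Vx y : V y -> y = x by move=> Vy; apply: contrapT => yx; apply: nV; exists y.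
apply: (pX x); rewrite (_ : [set x] = V) //; apply/seteqP; split=> [y ->|y /Vx //].
by rewrite -(Vx v).
Qed.

Lemma shrink_pair (X : topologicalType) (W : set X) :
  hausdorff_space X -> compact [set: X] -> perfect X -> open W -> W !=set0 ->
  exists V : bool -> set X, [/\ forall b, open (V b), forall b, V b !=set0,
    forall b, closure (V b) `<=` W & V false `&` V true = set0].
Proof.
move=> hX cX pX oW W0; have [x Wx] := W0.
have [y Wy yx] := perfect_open_other x pX oW W0.
have hX' := hX; rewrite open_hausdorff in hX'.
have [[A B] /= [/set_mem Ay /set_mem Bx] [oA oB /eqP AB]] := hX' y x (introN eqP yx).
have [A' [oA' A'y A'W]] := regular_nbhs hX cX (openI oA oW) (conj Ay Wy).
have [B' [oB' B'x B'W]] := regular_nbhs hX cX (openI oB oW) (conj Bx Wx).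
exists (fun b => if b then A' else B'); split=> [[]//|[]|[]|].
- by exists y.
- by exists x.
- by move=> z /A'W[].
- by move=> z /B'W[].
- apply/seteqP; split=> // z [/(@subset_closure _ B') /B'W[Bz _]].
  by move=> /(@subset_closure _ A') /A'W[Az _]; rewrite -AB.
Qed.

(** A binary tree of nonempty open sets, where each node at level [n] contains the
    closures of its two disjoint children and the children lie in the [n]-th set
    of the countable family [O]. Compactness alone puts a point on every branch,
    and disjointness of siblings makes the points distinct. This is at once the
    Baire category theorem and the lower bound on cardinalities. *)
Lemma cantor_scheme (I : countType) (X : topologicalType) (U : set X) (O : I -> set X) :
  hausdorff_space X -> compact [set: X] -> perfect X -> open U -> U !=set0 ->
  (forall i, open (O i)) ->
  (forall i V, open V -> V !=set0 -> V `<=` U -> V `&` O i !=set0) ->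
  exists f : (nat -> bool) -> X,
    injective f /\ forall s, (U `&` \bigcap_i O i) (f s).
Proof.
move=> hX cX pX oU U0 oO dO.
pose good (V : set X) := [/\ open V, V !=set0 & V `<=` U].
(* The family [O], padded by the full space at numbers that code no index. *)
pose G (n : nat) : set X := if unpickle n is Some i then O i else setT.
have GO n V : good V -> open (V `&` G n) /\ V `&` G n !=set0.
  move=> [oV V0 VU]; rewrite /G; case: unpickle => [i|]; last by rewrite setIT.
  by split; [exact: openI|exact: dO].
have step (p : set X * nat) : exists V : bool -> set X, good p.1 ->
    [/\ forall b, good (V b), forall b, closure (V b) `<=` p.1 `&` G p.2
      & V false `&` V true = set0].
  case: p => V n /=; have [gV|ngV] := pselect (good V); last by exists (fun=> V).
  have [oVG VG0] := GO n V gV; have [_ _ VU] := gV.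
  have [W [oW W0 WV WW]] := shrink_pair hX cX pX oVG VG0.
  exists W => _; split => // b; split => // z Wz; apply: VU.
  by have [] := WV b z (subset_closure Wz).
have [g gP] := choice step.
pose F := fix F (s : nat -> bool) (n : nat) : set X :=
  if n is m.+1 then g (F s m, m) (s m) else U.
have Fgood s n : good (F s n).
  elim: n => [|n IH]; first by split.
  by have [H _ _] := gP (F s n, n) IH; exact: H.
have Fcl s n : closure (F s n.+1) `<=` F s n `&` G n.
  by have [_ H _] := gP (F s n, n) (Fgood s n); exact: H.
have Fmono s m n : (m <= n)%N -> F s n `<=` F s m.
  elim: n => [|n IH]; first by rewrite leqn0 => /eqP ->.
  rewrite leq_eqVlt => /orP[/eqP -> //|]; rewrite ltnS => /IH {}IH; apply: subset_trans IH.
  by move=> z /(@subset_closure _ _) /Fcl[].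
have pt s : exists x, forall n, F s n x.
  apply: contrapT => nx.
  have [|||||A [n _ <-] Fn] := @directed_closed_subset_open X
    [set closure (F s n) | n in setT] set0 cX.
  - by exists (closure (F s 0)), 0.
  - by move=> _ [n _ <-]; exact: closed_closure.
  - move=> _ _ [m _ <-] [n _ <-]; exists (closure (F s (maxn m n))); first by exists (maxn m n).
    by move=> z Fz; split; apply: closureS Fz; apply: Fmono; rewrite ?leq_maxl ?leq_maxr.
  - exact: open0.
  - move=> z Fz; apply: nx; exists z => n.
    by have /Fcl[] : closure (F s n.+1) z by apply: Fz; exists n.+1.
  - have [_ [y Fy] _] := Fgood s n.
    exact: (Fn y (subset_closure Fy)).
have [f fP] := choice pt; exists f; split; last first.
  move=> s; split; first exact: (fP s 0).
  move=> i _; have /(@subset_closure _ _)/Fcl[_] := fP s (pickle i).+1.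
  by rewrite /G pickleK.
move=> s t fst; apply: contrapT => st.
have ex : exists n, s n != t n.
  by apply: contrapT => nex; apply/st/funext => n; apply: contrapT => /eqP ?; apply: nex; exists n.
case: (ex_minnP ex) => n nst minn.
have agree m : (m <= n)%N -> F s m = F t m.
  elim: m => //= m IH mn; rewrite IH; last exact: ltnW.
  congr (g _ _); apply/eqP; apply: contraLR mn => /minn.
  by rewrite leqNgt.
have [_ _ dis] := gP (F t n, n) (Fgood t n).
have := fP s n.+1; have := fP t n.+1; rewrite -fst /= agree //.
case: (s n) (t n) nst => [] [] //= _ A B.
  have : (g (F t n, n) false `&` g (F t n, n) true) (f s) by [].
  by rewrite dis.
have : (g (F t n, n) false `&` g (F t n, n) true) (f s) by [].
by rewrite dis.
Qed.

(** Letting the pair of basic sets with disjoint closures vary encodes, with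
    countably many open conditions, that clopen sets around a point shrink to it.
    Other pairs impose no condition. *)
Definition separating_clopens (X : topologicalType) (B : nat -> set X)
    (ij : nat * nat) : set X :=
  if `[< closure (B ij.1) `&` closure (B ij.2) = set0 >] then
    \bigcup_(E in [set E | clopen E /\
       (E `&` B ij.1 = set0 \/ E `&` B ij.2 = set0)]) E
  else setT.

Lemma separating_clopens_open (X : topologicalType) (B : nat -> set X) ij :
  open (separating_clopens B ij).
Proof.
rewrite /separating_clopens; case: asboolP => _; last exact: openT.
by apply: bigcup_open => E [[]].
Qed.

(** A singleton component has arbitrarily small clopen neighbourhoods, and two
    basic sets with disjoint closures cannot both have the point in their closure,
    so one of them can be avoided. Conversely a second point [z] in the component of
    [x] would have a basic neighbourhood separated from one of [x]; a clopen set
    around [x] missing the former would split the component. *)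
Lemma C1_bigcap (X : topologicalType) (B : nat -> set X) :
  hausdorff_space X -> compact [set: X] -> countable_base B ->
  C1 X = \bigcap_ij separating_clopens B ij.
Proof.
move=> hX cX [oB bB]; apply/seteqP; split=> x.
  move=> C1x [i j] _; rewrite /separating_clopens/=; case: asboolP => // Bij.
  have key k : ~ closure (B k) x -> exists E, [/\ clopen E, E x & E `&` B k = set0].
    move=> nx; have [|//|E [cE Ex EB]] := @C1_clopen_nbhs X x (~` closure (B k)) hX cX C1x.
      exact/closed_openC/closed_closure.
    exists E; split => //; apply/disjoints_subset; apply: subset_trans EB _.
    exact/subsetC/subset_closure.
  have [Bix|/key[E [cE Ex EB]]] := pselect (closure (B i) x); last first.
    by exists E => //; split => //; left.
  have [|E [cE Ex EB]] := key j; last by exists E => //; split => //; right.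
  by move=> Bjx; have : (closure (B i) `&` closure (B j)) x by []; rewrite Bij.
move=> xS; rewrite /C1 /=; apply/seteqP; split; last first.
  by move=> _ ->; exact: connected_component_refl.
move=> z [D [Dx _ cD] Dz]; apply: contrapT => zx.
have hX' := hX; rewrite open_hausdorff in hX'.
have [[V W] /= [/set_mem Vz /set_mem Wx] [oV oW /eqP VW]] := hX' z x (introN eqP zx).
have [V' [oV' V'z V'V]] := regular_nbhs hX cX oV Vz.
have [W' [oW' W'x W'W]] := regular_nbhs hX cX oW Wx.
have [i [Biz BiV]] := bB z V' oV' V'z.
have [j [Bjx BjW]] := bB x W' oW' W'x.
have := xS (i, j) Logic.I; rewrite /separating_clopens /=; case: asboolP; last first.
  move=> []; apply/seteqP; split=> // y [yi yj]; rewrite -VW; split.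
    exact/V'V/(closureS BiV).
  exact/W'W/(closureS BjW).
move=> _ [E [cE EB] Ex]; have Ez := clopen_connected cE cD Dx Ex Dz.
case: EB => EB.
  by have : (E `&` B i) z by []; rewrite EB.
by have : (E `&` B j) x by []; rewrite EB.
Qed.

Lemma C1_Gdelta (X : topologicalType) (B : nat -> set X) :
  hausdorff_space X -> compact [set: X] -> countable_base B -> Gdelta (C1 X).
Proof.
move=> hX cX bB.
exists (fun n => if unpickle n is Some ij then separating_clopens B ij else setT).
  move=> n; case: unpickle => [ij|]; last exact: openT.
  exact: separating_clopens_open.
rewrite (C1_bigcap hX cX bB); apply/seteqP; split=> x Sx.
  by move=> n _; case: unpickle => // ij; exact: Sx.
by move=> ij _; have := Sx (pickle ij) Logic.I; rewrite pickleK.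
Qed.

Lemma set_inj_card_le (T U : Type) (A : set T) (C : set U) (f : T -> U) :
  set_fun A C f -> set_inj A f -> A #<= C.
Proof.
move=> fAC fi; have [g] : $|{injfun A >-> C}| by apply/injfunPex; exists f.
exact: inj_card_le.
Qed.

(** The lower bound is a Cantor scheme inside the dense open sets whose
    intersection is [C1 X]; for the upper bound a point is determined by the
    basic open sets that contain it. *)
Lemma C1_card (X : topologicalType) (B : nat -> set X) :
  hausdorff_space X -> compact [set: X] -> perfect X -> [set: X] !=set0 ->
  countable_base B -> dense (C1 X) -> C1 X #= [set: nat -> bool].
Proof.
move=> hX cX pX X0 bB dC; apply: Cantor_Bernstein.
  apply: (@set_inj_card_le _ _ _ _ (fun x n => `[< B n x >])) => [//|x y _ _ exy].
  apply: contrapT => xy; have hX' := hX; rewrite open_hausdorff in hX'.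
  have [[V W] /= [/set_mem Vx /set_mem Wy] [oV oW /eqP VW]] := hX' x y (introN eqP xy).
  have [n [Bnx BnV]] := bB.2 x V oV Vx.
  have Bny : B n y.
    by apply/asboolP; move: (congr1 (@^~ n) exy) => /= <-; exact/asboolP.
  have : (V `&` W) y by split => //; exact: BnV.
  by rewrite VW.
have [||f [injf fP]] := @cantor_scheme _ X setT (separating_clopens B) hX cX pX openT X0.
- exact: separating_clopens_open.
- move=> ij V oV V0 _; have [x [Vx]] := dC V V0 oV.
  by rewrite (C1_bigcap hX cX bB) => Sx; exists x; split => //; exact: Sx.
apply: (@set_inj_card_le _ _ _ _ f); last by move=> s t _ _ /injf.
by move=> s _; rewrite (C1_bigcap hX cX bB); exact: (fP s).2.
Qed.

(** When [X] is compact Hausdorff this says that every component of [X] that meets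
    [V] leaves [V]; it is the form in which that property is used. *)
Definition clopen_free (X : topologicalType) (V : set X) :=
  forall E : set X, clopen E -> E `<=` V -> E = set0.

(** If every nonempty open subset of [U] contained a nonempty clopen set, then each
    of the open sets [separating_clopens B ij] would be dense in [U], and the Baire
    category theorem would give a point of [C1 X] in [U]. *)
Lemma clopen_free_open (X : topologicalType) (B : nat -> set X) :
  hausdorff_space X -> compact [set: X] -> perfect X -> countable_base B ->
  ~ dense (C1 X) ->
  exists V : set X, [/\ open V, V !=set0 & clopen_free V].
Proof.
move=> hX cX pX bB nd; apply: contrapT => nV; apply: nd => U U0 oU.
have [||f [_ fP]] := @cantor_scheme _ X U (separating_clopens B) hX cX pX oU U0.
- exact: separating_clopens_open.
- move=> [i j] W oW W0 _; rewrite /separating_clopens/=; case: asboolP; last by rewrite setIT.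
  move=> Bij.
  have key k : W `\` closure (B k) !=set0 -> exists E,
      [/\ clopen E, E !=set0, E `<=` W & E `&` B k = set0].
    move=> WB0; apply: contrapT => nE; apply: nV; exists (W `\` closure (B k)); split => //.
      by apply: openI => //; exact/closed_openC/closed_closure.
    move=> E cE EW; apply: contrapT => /eqP/set0P E0; apply: nE; exists E; split=> //.
      by move=> z /EW[].
    by apply/seteqP; split=> // z [/EW[_ nBz] /(@subset_closure _ _)].
  have [[E [cE [z Ez] EW EB]]|nki] := pselect (exists E,
      [/\ clopen E, E !=set0, E `<=` W & E `&` B i = set0]).
    by exists z; split; [exact: EW|exists E => //; split => //; left].
  have [[E [cE [z Ez] EW EB]]|nkj] := pselect (exists E,
      [/\ clopen E, E !=set0, E `<=` W & E `&` B j = set0]).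
    by exists z; split; [exact: EW|exists E => //; split => //; right].
  case: W0 => w Ww; have : (closure (B i) `&` closure (B j)) w.
    by split; apply: contrapT => nw; [apply/nki/key|apply/nkj/key]; exists w.
  by rewrite Bij.
exists (f (fun=> true)); rewrite (C1_bigcap hX cX bB).
exact: fP.
Qed.

(** * Embeddings and cards *)

Lemma embedding_continuous (Y X : topologicalType) (f : Y -> X) :
  embedding f -> continuous f.
Proof. by move=> [_ ef]; apply/continuousP => V oV; apply/ef; exists V. Qed.

(** Compactness is intrinsic, so a subset of a card is compact in the ambient
    space exactly when it is compact in any compactification of the card. This is
    how information travels between the two. *)
Lemma embedding_compact (Y X : topologicalType) (f : Y -> X) (S : set Y) :
  embedding f -> compact (f @` S) <-> compact S.
Proof.
move=> ef; split; last first.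
  move=> cS; apply: continuous_compact => //.
  by apply: continuous_subspaceT; exact: embedding_continuous.
move=> cfS F FF FS.
have [_ [[s Ss <-] clfs]] := cfS (f @ F) _ (filterS (@preimage_image _ _ f S) FS).
exists s; split => // A N FA /=; rewrite nbhsE => -[U [oU Us] UN].
have [V oV VU] := (ef.2 U).1 oU.
have [|_ [[a Aa <-] Va]] := clfs (f @` A) V (filterS (@preimage_image _ _ f A) FA).
  by apply: open_nbhs_nbhs; split => //; rewrite -VU in Us.
by exists a; split => //; apply: UN; rewrite -VU.
Qed.

Lemma set_val_embedding (X : topologicalType) (A : set X) :
  embedding (set_val : set_type A -> X).
Proof.
split; first exact: val_inj.
by move=> U; split=> [[V oV <-]|[V oV <-]]; exists V.
Qed.

Lemma set_type_compact (X : topologicalType) (A : set X) :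
  compact A -> compact [set: set_type A].
Proof.
move=> cA; apply/(embedding_compact _ (set_val_embedding A)).
rewrite (_ : _ @` _ = A) //; apply/seteqP; split=> [_ [[x /= /set_mem Ax] _ <-] //|x Ax].
by exists (exist _ x (mem_set Ax)).
Qed.

Lemma embedding_hausdorff (Y X : topologicalType) (f : Y -> X) :
  embedding f -> hausdorff_space X -> hausdorff_space Y.
Proof.
move=> ef; rewrite !open_hausdorff => hX x y xy.
have fxy : f x != f y by apply: contra_neq xy => /ef.1.
have [[A B] /= [/set_mem Ax /set_mem By] [oA oB /eqP AB]] := hX _ _ fxy.
exists (f @^-1` A, f @^-1` B) => /=; first by rewrite !inE.
split; [by apply/ef.2; exists A|by apply/ef.2; exists B|].
by rewrite -preimage_setI AB preimage_set0.
Qed.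

(** It is more convenient to treat a card as a space with an embedding into [X]
    whose range omits one point than through the subtype itself. *)
Lemma card_embedding (X Y : topologicalType) :
  is_card X Y <-> exists (x : X) (j : Y -> X), embedding j /\ range j = [set~ x].
Proof.
split=> [[x [f [g [fK gK cf cg]]]]|[x [j [ej rj]]]]; exists x.
  exists (set_val \o f); split.
    split; first by move=> a b /= /val_inj /(can_inj fK).
    move=> U; split=> [oU|[V oV <-]].
      have : open (g @^-1` U) by move/continuousP: cg; apply.
      move=> [V oV VU]; exists V => //.
      by rewrite comp_preimage VU; apply/seteqP; split=> z; rewrite /preimage/= fK.
    rewrite comp_preimage; move/continuousP: cf; apply.
    by apply/(set_val_embedding _).2; exists V.
  apply/seteqP; split=> [_ [y _ <-]|z zx]; first exact: set_valP.
  exists (g (exist _ z (mem_set zx))) => //=.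
  by rewrite gK.
have jx y : j y \in [set~ x] by apply/mem_set; rewrite -rj; exists y.
have gx (z : set_type [set~ x]) : exists y, j y = set_val z.
  have : range j (set_val z) by rewrite rj; exact: set_valP.
  by case=> y _ <-; exists y.
have [g gP] := choice gx.
exists (fun y => exist _ (j y) (jx y)), g; split.
- by move=> y; apply: ej.1; rewrite gP.
- by move=> z; apply: val_inj; rewrite /= gP.
- apply/continuousP => U /(set_val_embedding _).2[V oV <-].
  by apply/ej.2; exists V.
- apply/continuousP => U /ej.2[V oV <-].
  apply/(set_val_embedding _).2; exists V => //.
  by apply/seteqP; split=> z; rewrite /preimage/= gP.
Qed.

(** * Compactifications from colorings *)

(** A coloring cuts the card [X `\ x] into [n] clopen parts, each of which
    accumulates at [x]. The coloring lives on [X], so that it is independent of the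
    way in which the card is presented. *)
Definition coloring (X : topologicalType) (x : X) (n : nat) (c : X -> nat) :=
  [/\ forall y, (c y < n)%N,
      forall y, y <> x -> exists U, [/\ open U, U y & forall z, U z -> z <> x -> c z = c y]
    & forall i U, (i < n)%N -> open U -> U x -> exists y, [/\ U y, y <> x & c y = i]].

(** The disjoint sum of the closures of the color classes, each receiving its own
    copy [(i, x)] of the missing point. *)
Definition color_pieces (X : topologicalType) (x : X) (n : nat) (c : X -> nat) :
    set (nat * X) :=
  [set p | (p.1 < n)%N /\ (p.2 = x \/ c p.2 = p.1)].

Lemma nbhs_slice (X : topologicalType) (p : nat * X) (U : set X) :
  open U -> U p.2 -> nbhs p ([set p.1] `*` U).
Proof.
move=> oU Up; exists ([set p.1], U) => //; split => /=; last exact: open_nbhs_nbhs.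
exact: discrete_set1.
Qed.

Lemma color_pieces_compact (X : topologicalType) (x : X) (n : nat) (c : X -> nat) :
  hausdorff_space X -> compact [set: X] -> coloring x n c ->
  compact (color_pieces x n c).
Proof.
move=> hX cX [cn cloc _].
apply: (@subclosed_compact _ _ (`I_n `*` setT)); last by move=> p [].
  move=> p clp; split.
    have [q [[qn _] [/= qp _]]] := clp _ (nbhs_slice openT (I : setT p.2)).
    by rewrite -qp.
  have [->|px] := pselect (p.2 = x); [by left|right].
  have [U [oU Up cU]] := cloc _ px.
  have oUx : open (U `&` ~` [set x]).
    apply: openI => //; apply: closed_openC.
    by apply: accessible_closed_set1; exact: hausdorff_accessible.
  have [q [[_ qS] [/= qp [Uq qx]]]] := clp _ (nbhs_slice oUx (conj Up px)).
  by rewrite -qp -(cU _ Uq qx); case: qS.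
by apply: compact_setX => //; apply: finite_compact; exact: finite_II.
Qed.

(** Sending a point to its copy in the piece of its own color is an embedding; the
    remainder consists of the [n] copies of [x], and these are limits of the range
    because every color accumulates at [x]. *)
Lemma coloring_compactification (X Y : topologicalType) (x : X) (j : Y -> X)
    (n : nat) (c : X -> nat) :
  hausdorff_space X -> compact [set: X] -> embedding j -> range j = [set~ x] ->
  coloring x n c ->
  exists (K : topologicalType) (e : Y -> K), point_compactification n e.
Proof.
move=> hX cX ej rj col; have [cn cloc cacc] := col.
pose S := color_pieces x n c.
have jx y : j y <> x by have : range j (j y) by [exists y]; rewrite rj.
have jS y : (c (j y), j y) \in S by apply/mem_set; split; [exact: cn|right].
pose e y : set_type S := exist _ (c (j y), j y) (jS y).
have Xj z : z <> x -> exists y, j y = z.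
  move=> zx; have : [set~ x] z by [].
  by rewrite -rj => -[y _ <-]; exists y.
have cfst : continuous (@fst nat X) by move=> p; exact: cvg_fst.
have csnd : continuous (@snd nat X) by move=> p; exact: cvg_snd.
have ce : continuous e.
  apply/continuousP => U /(set_val_embedding S).2[V oV <-].
  rewrite openE => y; rewrite /preimage/= => Vy.
  have : nbhs (c (j y), j y) V by exact: open_nbhs_nbhs.
  move=> [[A B] /= [Ay By] ABV]; rewrite /interior.
  have [U' [oU' U'y cU']] := cloc _ (jx y).
  have cj := embedding_continuous ej.
  have nU' : nbhs y (j @^-1` (B `&` U')).
    by apply: cj; apply: filterI => //; exact: open_nbhs_nbhs.
  apply: filterS nU' => z [Bz U'z]; apply: ABV; split => //=.
  rewrite (cU' _ U'z (jx z)).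
  exact: nbhs_singleton Ay.
exists (set_type S), e; split; first split.
- by apply: set_type_compact; exact: color_pieces_compact.
- apply: embedding_hausdorff (set_val_embedding S) _.
  move=> p q clpq.
  have c1 : p.1 = q.1.
    have /= [r [[/= -> _] [/= -> _]] //] :=
      clpq _ _ (nbhs_slice openT (I : setT p.2)) (nbhs_slice openT (I : setT q.2)).
  rewrite (surjective_pairing p) (surjective_pairing q) c1; congr pair.
  apply: hX => A B pA qB.
  have [||r [Ar Br]] := clpq (snd @^-1` A) (snd @^-1` B); [exact: csnd|exact: csnd|].
  by exists r.2.
- split; first by move=> y z /(congr1 set_val) [_ /ej.1].
  move=> U; split=> [/ej.2[V oV <-]|[V oV <-]]; last by move/continuousP: ce; apply.
  exists (set_val @^-1` (snd @^-1` V)) => //.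
  apply/(set_val_embedding S).2; exists (snd @^-1` V) => //.
  by move/continuousP: csnd; apply.
- move=> U [[[i z] iS] Up] /(set_val_embedding S).2[V oV VU].
  have := set_mem iS => -[/= ni iz].
  have [zx|zx] := pselect (z = x); last first.
    have [y yz] := Xj _ zx; exists (e y); split; last by exists y.
    rewrite (_ : e y = exist _ (i, z) iS) //; apply: val_inj => /=.
    by rewrite yz; case: iz => // ->.
  move: Up; rewrite -VU /preimage/= => Viz.
  have : nbhs (i, z) V by exact: open_nbhs_nbhs.
  move=> [[A B] /= [Ai]]; rewrite nbhsE => -[B' [oB' B'z] B'B] ABV.
  subst z; have [w [B'w wx cw]] := cacc i B' ni oB' B'z.
  have [y yw] := Xj _ wx; exists (e y); split; last by exists y.
  apply: ABV; split => /=; last by rewrite yw; exact: B'B.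
  by rewrite yw cw; exact: nbhs_singleton Ai.
(* [f] enumerates the points [(i, x)] of the remainder; the cases beyond [n] only
   provide a default value. *)
have fS (i : nat) : exists p : set_type S, (i < n)%N -> set_val p = (i, x).
  have [ni|ni] := pselect (i < n)%N.
    have iS : (i, x) \in S by apply/mem_set; split => //; left.
    by exists (exist _ (i, x) iS).
  have [y|nY] := pselect (exists y : Y, True).
    by exists (e (projT1 (cid y))).
  have [n0|n0] := posnP n; last first.
    have zS : (0, x) \in S by apply/mem_set; split => //; left.
    by exists (exist _ (0, x) zS).
  by have := cn x; rewrite n0.
have [f fP] := choice fS.
rewrite card_eq_sym (_ : ~` range e = f @` `I_n).
  rewrite card_eq_sym; apply: inj_card_eq => i k /set_mem/= ni /set_mem/= nk fik.
  by have := fP i ni; rewrite fik fP // => -[].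
apply/seteqP; split=> [[[i z] iS] ne|_ [i /= ni <-]].
  have := set_mem iS => -[/= ni iz].
  have zx : z = x.
    apply: contrapT => zx; have [y yz] := Xj _ zx; apply: ne; exists y => //.
    by apply: val_inj => /=; rewrite yz; case: iz => // ->.
  exists i => //; apply: val_inj; rewrite /= zx; exact: fP.
move=> [y _ ey]; have := fP i ni; rewrite -ey => -[_]; exact: jx.
Qed.

(** * Dense singleton components leave no maximal compactification *)

Lemma decreasing_nbhs_base (X : topologicalType) (B : nat -> set X) (x : X) :
  countable_base B -> exists U : nat -> set X,
    [/\ forall n, open (U n), forall n, U n x,
        forall m n, (m <= n)%N -> U n `<=` U m
      & forall V, open V -> V x -> exists n, U n `<=` V].
Proof.
move=> [oB bB].
pose U := fix U n := if n is m.+1 then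
  U m `&` (if `[< B m x >] then B m else setT) else [set: X].
have Umono m n : (m <= n)%N -> U n `<=` U m.
  elim: n => [|n IH]; first by rewrite leqn0 => /eqP ->.
  by rewrite leq_eqVlt => /orP[/eqP -> //|]; rewrite ltnS => /IH {}IH z [/IH].
exists U; split=> //.
- elim=> [|n IH]; first exact: openT.
  by apply: openI => //; case: asboolP => _; [exact: oB|exact: openT].
- by elim=> [//|n IH]; split => //; case: asboolP.
- move=> V oV Vx; have [n [Bnx BnV]] := bB x V oV Vx; exists n.+1.
  by move=> z [_]; case: asboolP => // _; exact: BnV.
Qed.

(** Every punctured neighbourhood of [x] contains points of [C1 X] and so nonempty
    clopen sets. Choosing them one at a time, disjoint from the earlier ones and
    inside [U k], yields clopen layers [S k.+1 `\` S k] that converge to [x]. *)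
Lemma clopen_exhaustion (X : topologicalType) (x : X) (U : nat -> set X) :
  hausdorff_space X -> compact [set: X] -> perfect X -> dense (C1 X) ->
  (forall n, open (U n)) -> (forall n, U n x) ->
  exists S : nat -> set X, [/\ S 0 = set0, forall k, clopen (S k), forall k, ~ S k x &
    forall k, [/\ S k `<=` S k.+1, S k.+1 `\` S k !=set0 & S k.+1 `\` S k `<=` U k]].
Proof.
move=> hX cX pX dC oU Ux.
have cx : closed [set x].
  by apply: accessible_closed_set1; exact: hausdorff_accessible.
have step (p : set X * nat) : exists A : set X, clopen p.1 -> ~ p.1 x ->
    [/\ clopen A, A !=set0 & A `<=` U p.2 `&` ~` p.1 `&` ~` [set x]].
  case: p => S k /=.
  have [[oS cS]|nS] := pselect (clopen S); last by exists set0.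
  have [Sx|nSx] := pselect (S x); first by exists set0.
  have oUS : open (U k `&` ~` S) by apply: openI => //; exact: closed_openC.
  have [y USy yx] := perfect_open_other x pX oUS (ex_intro _ x (conj (Ux k) nSx)).
  have oW := openI oUS (closed_openC cx).
  have [z [Wz C1z]] := dC _ (ex_intro _ y (conj USy yx)) oW.
  have [A [cA Az AW]] := C1_clopen_nbhs hX cX C1z oW Wz.
  by exists A => _ _; split => //; exists z.
have [g gP] := choice step.
(* [S] accumulates the sets chosen so far, so the next one avoids them all. *)
pose S := fix S n := if n is m.+1 then S m `|` g (S m, m) else set0 : set X.
have SP k : clopen (S k) /\ ~ S k x.
  elim: k => [|k [cS nS]] /=; first by split => //; exact: clopen0.
  have [cA _ AU] := gP (S k, k) cS nS.
  by split; [exact: clopenU|move=> [//|/AU[_]]; apply].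
exists S; split => [//|k|k|k]; [exact: (SP k).1|exact: (SP k).2|].
have [_ [a Aa] AU] := gP (S k, k) (SP k).1 (SP k).2.
split=> [z Sz|/=|z [[//|/AU[[Uz _] _]]]] //; first by left.
by exists a; split; [right|have [[_]] := AU a Aa].
Qed.

(** Color the [k]-th layer of the exhaustion by [k %% n] and everything outside the
    layers by 0. Away from [x] only finitely many layers matter, so this is locally
    constant, and each residue class contains layers arbitrarily close to [x]. *)
Lemma dense_C1_coloring (X : topologicalType) (B : nat -> set X) (x : X) (n : nat) :
  hausdorff_space X -> compact [set: X] -> perfect X -> countable_base B ->
  dense (C1 X) -> (0 < n)%N -> exists c, coloring x n c.
Proof.
move=> hX cX pX bB dC n0.
have [U [oU Ux Umono Ub]] := decreasing_nbhs_base x bB.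
have [S [S0 cS Sx SU]] := clopen_exhaustion hX cX pX dC oU Ux.
have Smono k m : (k <= m)%N -> S k `<=` S m.
  elim: m => [|m IH]; first by rewrite leqn0 => /eqP ->.
  rewrite leq_eqVlt => /orP[/eqP -> //|]; rewrite ltnS => /IH {}IH z /IH.
  by have [+ _ _] := SU m; apply.
have cex y : exists i, ((forall k, ~ S k y) -> i = 0) /\
    forall k, S k.+1 y -> ~ S k y -> i = k.
  have [yS|nyS] := pselect (exists k, `[< S k y >]); last first.
    by exists 0; split => // k Sy; case: nyS; exists k.+1; exact/asboolP.
  case: (ex_minnP yS) => -[|m] /asboolP Smy minm; first by rewrite S0 in Smy.
  exists m; split=> [nS|k Sky nSky]; first by have := nS m.+1.
  apply/eqP; rewrite eqn_leq; apply/andP; split.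
    by rewrite -ltnS; apply: minm; exact/asboolP.
  by rewrite leqNgt; apply/negP => mk; apply: nSky; exact: Smono mk _ Smy.
have [r rP] := choice cex.
exists (fun y => r y %% n)%N; split => [y|y yx|i W ni oW Wx].
- by rewrite ltn_mod.
- have [yS|nyS] := pselect (exists k, `[< S k y >]).
    case: (ex_minnP yS) => -[|m] /asboolP Smy minm; first by rewrite S0 in Smy.
    have nSmy : ~ S m y by move=> Sm; have := minm m; rewrite ltnn => /(_ (introT (asboolP _) Sm)).
    exists (S m.+1 `\` S m); split => //.
      by apply: openI; [exact: (cS _).1|apply: closed_openC; exact: (cS _).2].
    by move=> z [Smz nSmz] _; rewrite ((rP z).2 m) // ((rP y).2 m).
  (* Beyond [S k] the exhaustion lives inside [W], so no layer comes near [y]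
     outside [S k], and the rank there is the default 0. *)
  have nSy k : ~ S k y by move=> Sk; apply: nyS; exists k; exact/asboolP.
  have hX' := hX; rewrite open_hausdorff in hX'.
  have [[V W] /= [/set_mem Vy /set_mem Wx] [oV oW /eqP VW]] := hX' y x (introN eqP yx).
  have [k UkW] := Ub W oW Wx.
  exists (V `\` S k); split => //.
    by apply: openI => //; apply: closed_openC; exact: (cS _).2.
  move=> z [Vz nSkz] _; rewrite (rP y).1 // (rP z).1 // => m.
  elim: m => [|m IH Smz]; first by rewrite S0.
  have [km|mk] := leqP k m; last by apply: nSkz; exact: Smono mk _ Smz.
  have [_ _ SmU] := SU m.
  have : (V `&` W) z by split => //; apply/UkW/(Umono _ _ km)/SmU.
  by rewrite VW.
- have [k UkW] := Ub W oW Wx.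
  have [_ [y [Sy nSy]] SmU] := SU (k * n + i)%N.
  exists y; split.
  + apply/UkW/(Umono _ (k * n + i)%N); last exact: SmU.
    by apply: leq_trans (leq_addr _ _); rewrite leq_pmulr.
  + by move=> yx; apply: (Sx _); rewrite -yx; exact: Sy.
  + by rewrite ((rP y).2 (k * n + i)%N) // modnMDl modn_small.
Qed.

Lemma constant_coloring (X : topologicalType) (x : X) :
  perfect X -> coloring x 1 (fun=> 0).
Proof.
move=> pX; split=> // [y _|i U]; first by exists setT; split => //; exact: openT.
rewrite ltnS leqn0 => /eqP -> oU Ux.
by have [y Uy yx] := perfect_open_other x pX oU (ex_intro _ x Ux); exists y.
Qed.

(** A coloring with [N.+1] colors beats a supposed maximal [N]-point
    compactification. *)
Lemma dense_C1_no_maximal (X Y : topologicalType) (B : nat -> set X) :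
  hausdorff_space X -> compact [set: X] -> perfect X -> countable_base B ->
  dense (C1 X) -> is_card X Y -> ~ has_maximal_finite_compactification Y.
Proof.
move=> hX cX pX bB dC /card_embedding[x [j [ej rj]]] [N [K [e [_ maxN]]]].
have [c col] := dense_C1_coloring x hX cX pX bB dC (ltn0Sn N).
have [K' [e' /maxN]] := coloring_compactification hX cX ej rj col.
by rewrite ltnn.
Qed.

(** A compact metric space has a countable base, and both properties pull back along
    the homeomorphism. *)
Lemma metrizable_hausdorff_base (R : realType) (X : topologicalType) :
  compact [set: X] -> metrizable R X -> [set: X] !=set0 ->
  hausdorff_space X /\ exists B : nat -> set X, countable_base B.
Proof.
move=> cX [M [f [g [fK gK cf cg]]]] [x0 _].
have ef : embedding f.
  split; first exact: can_inj fK.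
  move=> U; split=> [oU|[V oV <-]]; last by move/continuousP: cf; apply.
  exists (g @^-1` U); first by move/continuousP: cg; apply.
  by apply/seteqP; split=> z; rewrite /preimage/= fK.
split; first exact: embedding_hausdorff ef (@metric_hausdorff R M).
pose P := HB.pack_for (pseudoPMetricType R) M (isPointed.Build M (f x0)).
have cM : compact [set: P].
  rewrite -(_ : f @` setT = setT).
    by apply: continuous_compact => //; exact: continuous_subspaceT.
  by apply/seteqP; split=> // z _; exists (g z).
have [BB /countable_injP[i ii] [oBB bBB]] := compact_second_countable cM.
pose Q n (V : set M) := BB V /\ i V = n.
have [C CP] : {C : nat -> set M & forall n, open (C n) /\ forall V, Q n V -> C n = V}.
  apply: (@choice _ _ (fun n W => open W /\ forall V, Q n V -> W = V)) => n.
  have [[V [BV iV]]|nV] := pselect (exists V, Q n V).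
    exists V; split; first exact: oBB.
    by move=> V' [BV' iV']; apply: ii; rewrite ?inE // iV'.
  by exists set0; split; [exact: open0|move=> V QV; case: nV; exists V].
exists (fun n => f @^-1` C n); split.
  by move=> n; move/continuousP: cf; apply; exact: (CP n).1.
move=> x U oU Ux; have [V oV VU] := (ef.2 U).1 oU.
have [|W [BW Wx] WV] := bBB (f x) V.
  by apply: open_nbhs_nbhs; split => //; rewrite -VU in Ux.
exists (i W); rewrite ((CP (i W)).2 W) //; split => // z Wz.
by rewrite -VU; exact: WV.
Qed.

(** * Large compactifications cut out sectors *)

(** The germ of [X] at [x] falls apart into three disjoint open pieces, all of which
    accumulate at [x]. *)
Definition sectors (X : topologicalType) (x : X) (G : 'I_3 -> set X) :=
  [/\ forall i, open (G i), forall i, ~ G i x, forall i, closure (G i) x,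
      forall i k, i != k -> G i `&` G k = set0
    & open ([set x] `|` \bigcup_i G i)].

Lemma finite_bigcup_closed (I : finType) (X : topologicalType) (P : I -> Prop) (F : I -> set X) :
  (forall i, P i -> closed (F i)) -> closed (\bigcup_(i in P) F i).
Proof.
by move=> cF; apply: closed_bigcup => //; exact: finite_finset.
Qed.

Lemma separate_closed_family (I : finType) (X : topologicalType) (Q : I -> set X) :
  hausdorff_space X -> compact [set: X] -> (forall i, closed (Q i)) ->
  (forall i k, i != k -> Q i `&` Q k = set0) ->
  exists O : I -> set X, [/\ forall i, open (O i), forall i, Q i `<=` O i
    & forall i k, i != k -> O i `&` O k = set0].
Proof.
move=> hX cX cQ Qd.
have sep i : exists AB : set X * set X, [/\ open AB.1, open AB.2, Q i `<=` AB.1,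
    \bigcup_(k in [set k | k != i]) Q k `<=` AB.2 & AB.1 `&` AB.2 = set0].
  have [||U [V H]] := separate_closed hX cX (cQ i)
    (@finite_bigcup_closed I X [set k | k != i] Q _); last by exists (U, V).
    by move=> k _; exact: cQ.
  apply/seteqP; split=> // z [Qiz [k ki Qkz]].
  have : (Q k `&` Q i) z by []; rewrite Qd //.
have [AB ABP] := choice sep.
(* [O i] is the neighbourhood of [Q i] intersected with those of the complements
   belonging to the other indices. *)
exists (fun i => (AB i).1 `&` ~` \bigcup_(k in [set k | k != i]) ~` (AB k).2); split.
- move=> i; have [oA _ _ _ _] := ABP i; apply: openI => //; apply: closed_openC.
  apply: finite_bigcup_closed => k _; have [_ oB _ _ _] := ABP k.
  exact: open_closedC.
- move=> i z Qz; have [_ _ QA _ _] := ABP i; split; first exact: QA.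
  move=> [k ki]; apply; have [_ _ _ QB _] := ABP k.
  by apply: QB; exists i => //=; rewrite eq_sym.
- move=> i k ik; apply/seteqP; split=> // z [[Az _] [_ nz]].
  have [_ _ _ _ <-] := ABP i; split=> //; apply: contrapT => nB.
  by apply: nz; exists i.
Qed.

(** Separate the remainder into three nonempty finite parts, with disjoint open
    neighbourhoods [O i], and let [G i] be the trace of [O i] on the card. What the
    three traces leave over is compact, hence closed in [X], which makes their union
    with [x] a neighbourhood of [x]. If [G i] stayed away from [x], it would lie in a
    compact subset of the card, whose image is closed in the compactification, and
    density would fail in [O i]. *)
Lemma large_compactification_sectors (X Y K : topologicalType) (x : X)
    (j : Y -> X) (e : Y -> K) (M : nat) :
  hausdorff_space X -> compact [set: X] -> embedding j -> range j = [set~ x] ->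
  point_compactification M e -> (2 < M)%N -> exists G, sectors x G.
Proof.
move=> hX cX ej rj [[cK hK ee de] remM] M3.
have jx y : j y <> x by have : range j (j y) by [exists y]; rewrite rj.
have Xj z : z <> x -> exists y, j y = z.
  move=> zx; have : [set~ x] z by [].
  by rewrite -rj => -[y _ <-]; exists y.
have [q [qM qi qs]] := card_set_bijP remM.
(* The numbering [q] of the remainder is cut at 0, 1 and everything from 2 on. *)
pose Q (i : 'I_3) := ~` range e `&` [set p | minn (q p) 2 = i].
have [||O [oO QO Od]] := @separate_closed_family _ K Q hK cK.
- move=> i; apply: (accessible_finite_set_closed.1 (hausdorff_accessible hK)).
  by apply: (@sub_finite_set _ _ (~` range e)); [move=> z []|exists M].
- move=> i k ik; apply/seteqP; split=> // z [[_ /= zi] [_ /= zk]].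
  by move/eqP: ik; apply; apply/val_inj; rewrite /= -zi -zk.
have Q0 i : Q i !=set0.
  have iM : `I_M i by apply: leq_trans M3; exact: ltn_ord.
  have [p rp qp] := qs _ iM; exists p; split => //=.
  by rewrite qp; apply/minn_idPl; rewrite -ltnS; exact: ltn_ord.
have remQ p : ~ range e p -> exists i, Q i p.
  move=> rp; have lt3 : (minn (q p) 2 < 3)%N by rewrite ltnS geq_minr.
  by exists (Ordinal lt3).
have transfer (S : set Y) : compact (e @` S) -> compact (j @` S).
  by move=> /(embedding_compact _ ee) cS; apply/(embedding_compact _ ej).
have jclosed (S : set Y) : compact (e @` S) -> closed (j @` S).
  by move=> /transfer; exact: compact_closed.
pose G i := j @` (e @^-1` O i).
exists G; split.
- move=> i; have oeO : open (e @^-1` O i) by move/continuousP: (embedding_continuous ee); apply.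
  have [V oV VO] := (ej.2 _).1 oeO.
  have -> : G i = V `&` ~` [set x].
    rewrite /G -VO; apply/seteqP; split=> [_ [y Vy <-]|z [Vz /Xj[y yz]]].
      by split => //; exact: jx.
    by exists y => //; rewrite /preimage/= yz.
  apply: openI => //; apply: closed_openC.
  by apply: accessible_closed_set1; exact: hausdorff_accessible.
- by move=> i [y _]; exact: jx.
- move=> i N /=; rewrite nbhsE => -[N' [oN' N'x] N'N].
  apply: contrapT => GN; have {}GN : G i `&` N' = set0.
    by apply/seteqP; split=> // z [Gz N'z]; apply: GN; exists z; split => //; exact: N'N.
  pose S := j @^-1` (~` N').
  have jS : j @` S = ~` N'.
    apply/seteqP; split=> [_ [y Sy <-] //|z nz].
    have [|y yz] := Xj z; first by move=> zx; apply: nz; rewrite zx.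
    by exists y => //; rewrite /S /preimage/= yz.
  have cS : compact S.
    apply/(embedding_compact _ ej); rewrite jS.
    by apply: subclosed_compact cX _ => //; exact: open_closedC.
  have ceS : closed (e @` S).
    by apply: compact_closed => //; apply/(embedding_compact _ ee).
  have [p [rp qp]] := Q0 i.
  have [|w [[Oey nSy] [y _ ey]]] := de (O i `\` e @` S) _ (openI (oO i) (closed_openC ceS)).
    exists p; split; first exact: QO.
    by move=> [y _ ye]; apply: rp; exists y.
  apply: nSy; exists y => // N'y; rewrite -ey in Oey.
  by have : (G i `&` N') (j y) by [split => //; exists y]; rewrite GN.
- move=> i k /Od Oik; apply/seteqP; split=> // z [[y Oy <-] [y' Oy']] /ej.1 yy'.
  by have : (O i `&` O k) (e y) by [split => //; rewrite -yy']; rewrite Oik.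
- pose S := e @^-1` (~` \bigcup_i O i).
  have eS : e @` S = ~` \bigcup_i O i.
    apply/seteqP; split=> [_ [y Sy <-] //|z nz].
    have [[y _ yz]|/remQ[i Qi]] := pselect (range e z).
      by exists y => //; rewrite /S /preimage/= yz.
    by exfalso; apply: nz; exists i => //; exact: QO.
  have -> : [set x] `|` \bigcup_i G i = ~` (j @` S).
    apply/seteqP; split=> [z [->|[i _ [y Oy <-]]] [y' Sy']|z nz].
    + exact: jx.
    + by move=> /ej.1 yy'; apply: Sy'; exists i => //; rewrite yy'.
    + have [->|/Xj[y yz]] := pselect (z = x); [by left|right].
      apply: contrapT => nG; apply: nz; exists y => // -[i _ Oi]; apply: nG.
      by exists i => //; exists y.
  apply: closed_openC; apply: jclosed; rewrite eS.
  apply: subclosed_compact cK _ => //; apply: open_closedC.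
  by apply: bigcup_open => i _; exact: oO.
Qed.

(** * Points with three sectors are rare *)

Lemma sector_closure (X : topologicalType) (x : X) (G : 'I_3 -> set X) i :
  sectors x G ->
  closure (G i) `&` ([set x] `|` \bigcup_i G i) `<=` G i `|` [set x].
Proof.
move=> [oG _ _ dG _] z [clz [->|[k _ Gkz]]]; first by right.
have [->|ik] := eqVneq i k; first by left.
have [y] := clz _ (open_nbhs_nbhs (conj (oG k) Gkz)).
by rewrite (dG _ _ ik).
Qed.

Lemma sector_slice_closed (X : topologicalType) (x : X) (G : 'I_3 -> set X) (O : set X) i :
  hausdorff_space X -> sectors x G -> O x ->
  closure O `<=` [set x] `|` \bigcup_i G i ->
  closed ((G i `|` [set x]) `&` closure O).
Proof.
move=> hX sG Ox OW z /closureI[]; rewrite closureU => Gz clOz.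
have Oz : closure O z by apply: closed_closure.
split => //; case: Gz => Gz; first exact: sector_closure sG _ (conj Gz (OW _ Oz)).
right; have := @accessible_closed_set1 _ (hausdorff_accessible hX) x; exact.
Qed.

(** Otherwise [x] is a component of [A], the part of the sector with [x] in a small
    closed neighbourhood. Then [x] has relatively clopen neighbourhoods in [A]: first
    [E], lying inside the open set [O], and then [E'], missing a point [y] of the
    sector in [E]. The difference of the two is closed, and it is open in [X]
    because it avoids both [x] and the boundary of [O]: a nonempty clopen set inside
    [V]. *)
Lemma sector_continuum (X : topologicalType) (V : set X) (x : X) (G : 'I_3 -> set X) i :
  hausdorff_space X -> compact [set: X] -> open V -> clopen_free V -> V x ->
  sectors x G ->
  exists D, [/\ connected D, D x, D `<=` G i `|` [set x] & exists2 y, D y & y <> x].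
Proof.
move=> hX cX oV fV Vx sG; have [oG Gx clG dG oW] := sG.
apply: contrapT => nD.
have [O [oO Ox OWV]] := regular_nbhs hX cX (openI oW oV)
  (conj (or_introl erefl : ([set x] `|` \bigcup_i G i) x) Vx).
pose A := (G i `|` [set x]) `&` closure O.
have OW : closure O `<=` [set x] `|` \bigcup_i G i by move=> z /OWV[].
have cA : closed A := sector_slice_closed hX sG Ox OW.
have Ax : A x by split; [right|exact: subset_closure].
have Dx D : connected D -> D `<=` A -> D x -> D `<=` [set x].
  move=> cD DA Dx z Dz; apply: contrapT => zx; apply: nD; exists D.
  by split => //; [move=> y /DA[]|exists z].
have split_off P : closed P -> ~ P x -> exists E F, [/\ closed_partition A E F, E x & E `&` P = set0].
  move=> cP Px; apply: split_off_closed => // D cD DA Dx0.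
  by apply/disjoints_subset => z Dz; rewrite (Dx _ cD DA Dx0 z Dz).
have [|nOx|E [F [[cE cF EF EIF] Ex EO]]] := split_off (~` O); first exact: open_closedC.
  exact: nOx.
have {}EO : E `<=` O by move/disjoints_subset: EO; rewrite setCK.
have [y [Gy [Oy nFy]]] : G i `&` (O `&` ~` F) !=set0.
  apply: (clG i); apply: open_nbhs_nbhs; split.
    by apply: openI => //; exact: closed_openC.
  by split => // Fx; have : (E `&` F) x by []; rewrite EIF.
have yx : y <> x by move=> yx; apply: (Gx i); rewrite -yx.
have [|xy|E' [F' [[cE' cF' EF' EIF'] E'x E'y]]] := split_off [set y].
- by apply: accessible_closed_set1; exact: hausdorff_accessible.
- exact/yx.
have Ay : A y by split; [left|exact: subset_closure].
have Hy : (E `&` F') y.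
  split; first by move: (Ay); rewrite -EF => -[].
  move: (Ay); rewrite -EF' => -[E'y'|//].
  by have : (E' `&` [set y]) y by []; rewrite E'y.
have EF'E : E `&` F' = G i `&` (O `&` ~` F) `&` ~` E'.
  apply/seteqP; split=> z.
    move=> [Ez F'z].
    have nE'z : ~ E' z by move=> E'z; have : (E' `&` F') z by []; rewrite EIF'.
    split => //; split; last first.
      by split; [exact: EO|move=> Fz; have : (E `&` F) z by []; rewrite EIF].
    have : A z by rewrite -EF; left.
    by move=> [[//|zx]]; case: nE'z; rewrite zx.
  move=> [[Gz [Oz nFz]] nE'z]; have Az : A z by split; [left|exact: subset_closure].
  by split; [move: (Az); rewrite -EF => -[]|move: (Az); rewrite -EF' => -[]].
have : E `&` F' = set0.
  apply: fV; last by move=> z [/EO/(@subset_closure _ _)/OWV[]].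
  split; last exact: closedI.
  rewrite EF'E; apply: openI; last exact: closed_openC.
  by apply: openI => //; apply: openI => //; exact: closed_openC.
by move=> E0; rewrite E0 in Hy.
Qed.

Definition boundary (X : topologicalType) (O : set X) := closure O `\` O.

(** A connected set in [A] from [x] to a point outside [closure O] prevents the
    component of [x] in the compact part of [A] in [closure O] from being cut off from
    the boundary: the piece cut off would be relatively clopen in that connected set
    as well. *)
Lemma boundary_bumping (X : topologicalType) (A D O : set X) (x y : X) :
  hausdorff_space X -> compact [set: X] -> open O -> O x ->
  closed (A `&` closure O) -> connected D -> D `<=` A -> D x -> D y -> ~ closure O y ->
  exists C, [/\ connected C, C x, C `<=` A `&` closure O & C `&` boundary O !=set0].
Proof.
move=> hX cX oO Ox cAO cD DA Dx Dy Oy; apply: contrapT => nC.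
have bO : closed (boundary O).
  by apply: closedI; [exact: closed_closure|exact: open_closedC].
have [|||C cC CA Cx|E [F [[cE cF EF EIF] Ex EO]]] :=
    @split_off_closed X (A `&` closure O) (boundary O) x hX cX.
- exact: cAO.
- by split; [exact: DA|exact: subset_closure].
- exact: bO.
- apply: contrapT => /eqP/set0P C0; apply: nC; exists C; split => //.
have EAO : E `<=` A `&` closure O by rewrite -EF; left.
have EO' : E `<=` O.
  move=> z Ez; apply: contrapT => nOz.
  by have : (E `&` boundary O) z by [split => //; split => //; have [] := EAO z Ez]; rewrite EO.
have DE : D `&` E = D.
  apply: cD; first by exists x.
  - exists (O `&` ~` F); first by apply: openI => //; exact: closed_openC.
    apply/seteqP; split=> z [Dz].
      move=> Ez; split => //; split; first exact: EO'.
      by move=> Fz; have : (E `&` F) z by []; rewrite EIF.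
    move=> [Oz nFz]; split => //.
    have : (A `&` closure O) z by split; [exact: DA|exact: subset_closure].
    by rewrite -EF => -[].
  - by exists E.
by apply: Oy; apply: subset_closure; apply: EO'; move: Dy; rewrite -DE => -[].
Qed.

Definition base_union (X : topologicalType) (B : nat -> set X) (s : seq nat) : set X :=
  \bigcup_(n in [set` s]) B n.

(** The sets [P `\` base_union B s], for the unions that lie in [G], are directed
    and have empty intersection, so one of them is empty. *)
Lemma compact_base_union (X : topologicalType) (B : nat -> set X) (P G : set X) :
  compact [set: X] -> countable_base B -> closed P -> open G -> P `<=` G ->
  exists s, P `<=` base_union B s /\ base_union B s `<=` G.
Proof.
move=> cX [oB bB] cP oG PG.
have oU s : open (base_union B s) by apply: bigcup_open => n _; exact: oB.
have [|||||_ [s sG <-] Ps] := @directed_closed_subset_open X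
    [set P `\` base_union B s | s in [set s | base_union B s `<=` G]] set0 cX.
- by exists (P `\` base_union B [::]), [::] => // z [n].
- by move=> _ [s _ <-]; apply: closedI => //; exact: open_closedC.
- move=> _ _ [s sG <-] [t tG <-].
  have stU : base_union B (s ++ t) = base_union B s `|` base_union B t.
    apply/seteqP; split=> [z [n /= ]|z [[n /= ns]|[n /= ns]] Bz].
    + by rewrite mem_cat => /orP[ns|nt] Bz; [left|right]; exists n.
    + by exists n => //=; rewrite mem_cat ns.
    + by exists n => //=; rewrite mem_cat ns orbT.
  exists (P `\` base_union B (s ++ t)).
    by exists (s ++ t) => //= z; rewrite stU => -[/sG|/tG].
  by rewrite stU => z [Pz nz]; split; split => // ?; apply: nz; [left|right].
- exact: open0.
- move=> z nz.
  have Pz : P z.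
    have /(_ _)[] // := nz (P `\` base_union B [::]).
    by exists [::] => // w [n].
  have [n [Bnz BnG]] := bB z G oG (PG z Pz).
  have [|_] := nz (P `\` base_union B [:: n]).
    by exists [:: n] => // w [k /=]; rewrite inE => /eqP -> /BnG.
  by apply; exists n => //=; rewrite inE.
- exists s; split => // z Pz; apply: contrapT => nz; exact: (Ps z).
Qed.

(** The code [t] names a basic neighbourhood of [x] and records how the three sectors
    partition its boundary, by finite unions of basic sets. There are countably many
    codes. The last clause, that each sector links [x] to its own part of the
    boundary, is what makes a code determine the point. *)
Definition sector_code (X : topologicalType) (B : nat -> set X)
    (t : nat * {ffun 'I_3 -> seq nat}) (x : X) :=
  B t.1 x /\ exists G, [/\ sectors x G,
    closure (B t.1) `<=` [set x] `|` \bigcup_i G i,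
    forall i, boundary (B t.1) `&` G i = boundary (B t.1) `&` base_union B (t.2 i)
  & forall i, exists C, [/\ connected C, C x,
      C `<=` (G i `|` [set x]) `&` closure (B t.1) & C `&` boundary (B t.1) !=set0]].

(** Each sector contains a nondegenerate connected set through [x]. Taking the basic
    neighbourhood so small that all three of them leave it, boundary bumping gives
    the links to the boundary. *)
Lemma sector_code_exists (X : topologicalType) (B : nat -> set X) (V : set X)
    (x : X) (G : 'I_3 -> set X) :
  hausdorff_space X -> compact [set: X] -> countable_base B ->
  open V -> clopen_free V -> V x -> sectors x G -> exists t, sector_code B t x.
Proof.
move=> hX cX bB oV fV Vx sG; have [oG Gx clG dG oW] := sG.
have c1 (y : X) : closed [set y].
  by apply: accessible_closed_set1; exact: hausdorff_accessible.
have DP i : exists Dy : set X * X, [/\ connected Dy.1, Dy.1 x, Dy.1 `<=` G i `|` [set x],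
    Dy.1 Dy.2 & Dy.2 <> x].
  have [D [cD Dx DG [y Dy yx]]] := sector_continuum i hX cX oV fV Vx sG.
  by exists (D, y).
have [D {}DP] := choice DP.
(* Excluding the points [(D i).2] forces each [D i] to leave the neighbourhood. *)
have oN : open (([set x] `|` \bigcup_i G i) `&` ~` \bigcup_i [set (D i).2]).
  apply: openI => //; apply: closed_openC; apply: finite_bigcup_closed => i _; exact: c1.
have Nx : (([set x] `|` \bigcup_i G i) `&` ~` \bigcup_i [set (D i).2]) x.
  by split; [left|move=> [i _ /= xy]; have [_ _ _ _] := DP i; rewrite -xy].
have [O [oO Ox ON]] := regular_nbhs hX cX oN Nx.
have [o [Box BoO]] := bB.2 x O oO Ox.
have BW : closure (B o) `<=` [set x] `|` \bigcup_i G i.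
  by move=> z /(closureS BoO)/ON[].
have oBo := bB.1 o.
have bx : ~ boundary (B o) x by move=> [_].
have bcl i : closed (boundary (B o) `&` G i).
  have -> : boundary (B o) `&` G i = (G i `|` [set x]) `&` closure (B o) `&` ~` B o.
    apply/seteqP; split=> z; first by move=> [[clz nz] Gz]; split => //; split => //; left.
    by move=> [[[Gz|->] clz] nz]; [split|case: nz].
  apply: closedI; last exact: open_closedC.
  exact: sector_slice_closed.
have sP i : exists s, boundary (B o) `&` G i `<=` base_union B s /\ base_union B s `<=` G i.
  by apply: compact_base_union => // z [].
have [s {}sP] := choice sP.
exists (o, [ffun i => s i]); split => //; exists G; split => //= i.
  rewrite ffunE; have [Ps sGi] := sP i; apply/seteqP; split=> z [bz zz].
    by split => //; exact: Ps.
  by split => //; exact: sGi.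
have [cD Dx DG Dy yx] := DP i.
apply: boundary_bumping cD DG Dx Dy _ => //; first exact: sector_slice_closed.
by move=> /(closureS BoO)/ON[_]; apply; exists i.
Qed.

(** Suppose that [x] and [x'] are distinct and share a code, and that [x'] lies in the
    sector [k] of [x]. In the other two sectors of [x] there are connected sets from
    [x] to two different parts of the boundary, and their union avoids [x']. But the
    sectors of [x'] induce the same partition of the boundary, so the union meets
    two disjoint sectors of [x'] while being covered by the three of them: it cannot
    be connected. *)
Lemma sector_code_inj (X : topologicalType) (B : nat -> set X) t (x x' : X) :
  sector_code B t x -> sector_code B t x' -> x = x'.
Proof.
case: t => o s [Bx [G [[oG Gx _ dG _] BW bG GC]]].
move=> [Bx' [G' [[oG' Gx' _ dG' _] BW' bG' _]]].
rewrite /= in Bx Bx' BW BW' bG bG' GC.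
apply: contrapT => xx'.
have [k Gk] : exists k, G k x'.
  by have [x'x|[k _ Gk]] := BW _ (subset_closure Bx'); [case: xx'|exists k].
have [i [l [ik lk il]]] : exists i l, [/\ i != k, l != k & i != l].
  pose a : 'I_3 := inord 0; pose b : 'I_3 := inord 1; pose c : 'I_3 := inord 2.
  have vE : (val a = 0) * (val b = 1) * (val c = 2) by rewrite /= !inordK.
  have [ka|ka] := eqVneq a k.
    by exists b, c; rewrite -ka -!val_eqE !vE.
  have [kb|kb] := eqVneq b k.
    by exists a, c; rewrite ka -kb -!val_eqE !vE.
  by exists a, b; rewrite ka kb -!val_eqE !vE.
have [Ci [cCi Cix CiG [p [Cip bp]]]] := GC i.
have [Cl [cCl Clx ClG [q [Clq bq]]]] := GC l.
have reach m C z : C `<=` (G m `|` [set x]) `&` closure (B o) -> C z ->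
    boundary (B o) z -> G' m z.
  move=> CG Cz bz; have [[Gz|zx] _] := CG z Cz; last by case: bz => _; rewrite zx.
  by have : (boundary (B o) `&` G m) z by []; rewrite bG -bG' => -[].
have Gip := reach _ _ _ CiG Cip bp.
have Glq := reach _ _ _ ClG Clq bq.
(* The two legs miss [x'], which lies in the third sector [k]. *)
have avoid m C z : m != k -> C `<=` (G m `|` [set x]) `&` closure (B o) -> C z ->
    exists n, G' n z.
  move=> mk CG Cz; have [Gz clz] := CG z Cz.
  have [zx'|[n _ Gnz]] := BW' z clz; last by exists n.
  exfalso; rewrite zx' in Gz; case: Gz => [Gmx'|x'x]; last exact: xx'.
  by have : (G m `&` G k) x' by []; rewrite dG.
pose C := Ci `|` Cl.
have cC : connected C by apply: connectedU => //; exists x.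
have CG z : C z -> exists n, G' n z.
  by move=> [/(avoid i)|/(avoid l)]; apply.
have CGi : C `&` G' i = C.
  apply: cC; first by exists p; split => //; left.
  - by exists (G' i).
  - exists (~` \bigcup_(n in [set n | n != i]) G' n).
      apply: open_closedC; apply: bigcup_open => n _; exact: oG'.
    apply/seteqP; split=> z [Cz Gz]; split => //.
      move=> [n /= ni Gnz]; have : (G' n `&` G' i) z by [].
      by rewrite dG'.
    have [n Gnz] := CG z Cz; have [<- //|ni] := eqVneq n i.
    by case: Gz; exists n.
have : (C `&` G' i) q by rewrite CGi; right.
move=> [_ Giq]; have : (G' i `&` G' l) q by [].
by rewrite dG'.
Qed.

(** In a clopen-free open set, every point with three sectors has a code, and each
    code belongs to at most one point. As no point is isolated, the Baire category
    theorem provides a point without a code. *)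
Lemma exists_sectorless_point (X : topologicalType) (B : nat -> set X) :
  hausdorff_space X -> compact [set: X] -> perfect X -> countable_base B ->
  ~ dense (C1 X) -> exists x : X, forall G, ~ sectors x G.
Proof.
move=> hX cX pX bB ndC.
have [V [oV V0 fV]] := clopen_free_open hX cX pX bB ndC.
have c1 (x : X) : closed [set x].
  by apply: accessible_closed_set1; exact: hausdorff_accessible.
have [t|t W oW W0 WV|f [_ fP]] := @cantor_scheme _ X V
    (fun t => ~` [set x | sector_code B t x]) hX cX pX oV V0.
- apply: closed_openC.
  have [[x tx]|nt] := pselect (exists x, sector_code B t x).
    rewrite (_ : [set _ | _] = [set x]); first exact: c1.
    by apply/seteqP; split=> [y /= ty|y ->] //; apply: sector_code_inj ty tx.
  rewrite (_ : [set _ | _] = set0); first exact: closed0.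
  by apply/seteqP; split=> // y ty; apply: nt; exists y.
- have [x tx] := W0.
  have [sx|nsx] := pselect (sector_code B t x); last by exists x.
  have [y Wy yx] := perfect_open_other x pX oW W0.
  by exists y; split => // ty; apply: yx; apply: sector_code_inj ty sx.
- exists (f xpredT) => G sG; have [Vf nf] := fP xpredT.
  have [t tf] := sector_code_exists hX cX bB oV fV Vf sG.
  exact: (nf t).
Qed.

(** At a point that does not have three sectors, the card has no compactification
    with three or more points at infinity. It has one with a single point, so the
    larger of 1 and 2 that occurs is the maximum. *)
Lemma not_dense_C1_maximal (X : topologicalType) (B : nat -> set X) :
  hausdorff_space X -> compact [set: X] -> perfect X -> countable_base B ->
  ~ dense (C1 X) -> exists Y : topologicalType, is_card X Y /\
    (has_maximal_point_compactification 1 Y \/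
     has_maximal_point_compactification 2 Y).
Proof.
move=> hX cX pX bB ndC.
have [x xG] := exists_sectorless_point hX cX pX bB ndC.
pose j : set_type [set~ x] -> X := set_val.
have ej : embedding j := set_val_embedding _.
have rj : range j = [set~ x].
  apply/seteqP; split=> [_ [y _ <-]|z zx]; first exact: set_valP.
  by exists (exist _ z (mem_set zx)).
have le2 M (K : topologicalType) (e : set_type [set~ x] -> K) :
    point_compactification M e -> (M <= 2)%N.
  move=> pe; rewrite leqNgt; apply/negP => M3.
  by have [G /xG] := large_compactification_sectors hX cX ej rj pe M3.
exists (set_type [set~ x]); split; first by apply/card_embedding; exists x, j.
have [[K [e pe]]|n2] := pselect (exists (K : topologicalType) (e : set_type [set~ x] -> K),
    point_compactification 2 e).
  by right; exists K, e; split.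
left; have [K [e pe]] := coloring_compactification hX cX ej rj (constant_coloring x pX).
exists K, e; split => // M K' e' pe'.
have := le2 _ _ _ pe'; rewrite leq_eqVlt ltnS => /orP[/eqP M2|//].
by case: n2; exists K', e'; rewrite -M2.
Qed.

Lemma no_isolated_perfect (X : topologicalType) :
  isolated [set: X] = set0 -> perfect X.
Proof.
move=> iX x ox; have : isolated [set: X] x.
  split; first exact/mem_set.
  by exists [set x]; [exact: open_nbhs_nbhs|rewrite setIT].
by rewrite iX.
Qed.

Theorem theorem2p7 (R : realType) (X : topologicalType)
    (X_nonempty : [set: X] !=set0)
    (X_compact : compact [set: X])
    (X_metrizable : metrizable R X)
    (X_no_isolated : isolated [set: X] = set0) :
  [<-> exists Y : topologicalType, is_card X Y /\
         (has_maximal_point_compactification 1 Y \/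
          has_maximal_point_compactification 2 Y);
       exists Y : topologicalType, is_card X Y /\
         has_maximal_finite_compactification Y;
       ~ dense (C1 X);
       ~ [/\ dense (C1 X), Gdelta (C1 X) & C1 X #= [set: nat -> bool]]].
Proof.
have pX := no_isolated_perfect X_no_isolated.
have [hX [B bB]] := metrizable_hausdorff_base X_compact X_metrizable X_nonempty.
tfae.
- by move=> [Y [cY [m1|m2]]]; exists Y; split => //; [exists 1|exists 2].
- move=> [Y [cY mY]] dC.
  exact: (dense_C1_no_maximal hX X_compact pX bB dC cY mY).
- by move=> ndC [].
- move=> nC; apply: (not_dense_C1_maximal hX X_compact pX bB) => dC.
  apply: nC; split => //; first exact: C1_Gdelta hX X_compact bB.
  exact: C1_card hX X_compact pX X_nonempty bB dC.
Qed.
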